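(* Let $Y$ be a regular sublattice of an infinitely distributive complete lattice $L$, and let $\iota:Y\to L$ be the inclusion map. If $\operatorname{DM}(Y)$ is infinitely distributive, then the canonical extension of $\iota$, $$\overline\iota:\operatorname{DM}(Y)\to L,\qquad \overline\iota(x)=\bigvee{}^{L}\{y\in Y: y\le x\},$$ is a lattice embedding of $\operatorname{DM}(Y)$ into $L$, and its image is join-regular in $L$.
   Context: A lattice $L$ is infinitely distributive if whenever $\bigvee A$ exists, $x\wedge\bigvee A=\bigvee_{a\in A}(x\wedge a)$ for every $x\in L$, and whenever $\bigwedge A$ exists, $x\vee\bigwedge A=\bigwedge_{a\in A}(x\vee a)$ for every $x\in L$. A lattice is complete if every subset, including the empty set, has a supremum and an infimum. A sublattice $Y$ of $L$ is regular in $L$ if every supremum or infimum of a nonempty subset of $Y$ that exists in $Y$ also exists in $L$, with the same value. A sublattice $M$ of $L$ is join-regular in $L$ if every supremum of a nonempty subset of $M$ that exists in $M$ also exists in $L$, with the same value. For $A\subseteq Y$, $A^+$ and $A^-$ denote the sets of upper and lower bounds of $A$ in $Y$. The Dedekind–MacNeille completion $\operatorname{DM}(Y)$ is the complete lattice of all $C\subseteq Y$ with $C=C^{+-}$, ordered by inclusion; $Y$ is embedded via $y\mapsto\mathord\downarrow y=\{z\in Y: z\le y\}$, so for $x\in\operatorname{DM}(Y)$ and $y\in Y$, $y\le x$ means $y\in x$. A lattice embedding is an injective map preserving binary joins and meets. *)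

(* Defs.v *)
From HB Require Import structures.
From mathcomp Require Import all_boot all_order.
From mathcomp Require Import boolp classical_sets.

Set Implicit Arguments.
Unset Strict Implicit.
Unset Printing Implicit Defensive.

Import Order.LTheory.
Local Open Scope classical_set_scope.

(* [supremums A s] reads "the supremum of A exists and equals s" ; the set A   *)
(* may be empty.                                                              *)
Definition infinitely_distributive d (T : latticeType d) : Prop :=
  (forall (A : set T) (s x : T), supremums A s ->
     supremums [set Order.meet x a | a in A] (Order.meet x s)) /\
  (forall (A : set T) (i x : T), infimums A i ->
     infimums [set Order.join x a | a in A] (Order.join x i)).

Definition complete d (T : porderType d) : Prop :=
  forall A : set T, (exists s, supremums A s) /\ (exists i, infimums A i).

(* The supremum operation of a complete poset; unlike [classical_sets.supremum] *)
(* it sends the empty set to the least element.                                *)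
Definition csup d (T : porderType d) (cT : complete T) (A : set T) : T :=
  projT1 (cid (cT A).1).

Lemma csupP d (T : porderType d) (cT : complete T) (A : set T) :
  supremums A (csup cT A).
Proof. exact: projT2 (cid (cT A).1). Qed.

(* A subset of a poset carries the induced order: for [A : set Y] below,       *)
(* [supremums A] is computed in [Y], and [supremums (val @` A)] in [L].        *)
HB.instance Definition _ d (L : porderType d) (Y : set L) :=
  [SubChoice_isSubPOrder of {x : L | x \in Y} by <: with d].

Section Sublattices.
Context d (L : latticeType d).
Implicit Type Y : set L.

Definition sublattice Y : Prop :=
  forall x y, Y x -> Y y -> Y (Order.meet x y) /\ Y (Order.join x y).

Definition join_regular Y : Prop :=
  sublattice Y /\
  forall (A : set Y) (s : Y), A !=set0 -> supremums A s ->
    supremums (val @` A) (val s).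

Definition regular Y : Prop :=
  [/\ sublattice Y,
      forall (A : set Y) (s : Y), A !=set0 -> supremums A s ->
        supremums (val @` A) (val s) &
      forall (A : set Y) (i : Y), A !=set0 -> infimums A i ->
        infimums (val @` A) (val i)].

End Sublattices.

Definition lattice_embedding d (T : latticeType d) d' (T' : latticeType d')
  (f : T -> T') : Prop :=
  [/\ injective f, Order.meet_morphism f & Order.join_morphism f].

Section DedekindMacNeille.
Context d (T : porderType d).
Implicit Type A : set T.

Definition DM_cut : set (set T) := [set C | C = lbound (ubound C)].

Definition DM : Type := set_type DM_cut.

HB.instance Definition _ := Order.SubPOrder.on DM.

Lemma DMP (C : DM) : val C = lbound (ubound (val C)).
Proof. exact: set_mem (valP C). Qed.

Lemma DM_leP (C D : DM) : reflect (val C `<=` val D) (C <= D)%O.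
Proof. exact: asboolP. Qed.

Lemma sub_lub A : A `<=` lbound (ubound A).
Proof. by move=> x Ax u; apply. Qed.

Lemma lubS A B : A `<=` B -> lbound (ubound A) `<=` lbound (ubound B).
Proof. by move=> AB x Ax u uB; apply: Ax => y /AB /uB. Qed.

Lemma DM_closureP A : lbound (ubound A) \in DM_cut.
Proof.
apply/mem_set/seteqP; split; first exact: sub_lub.
by move=> x h u uA; apply: h => y; apply.
Qed.

(* A^{+-} *)
Definition DM_closure A : DM := exist (fun C => C \in DM_cut) _ (DM_closureP A).

Lemma DM_closure_le A (C : DM) : A `<=` val C -> (DM_closure A <= C)%O.
Proof. by move=> AC; apply/DM_leP; rewrite [val C]DMP; apply: lubS. Qed.

Definition DM_meet (C D : DM) : DM := DM_closure (val C `&` val D).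
Definition DM_join (C D : DM) : DM := DM_closure (val C `|` val D).

Fact DM_lexI (E C D : DM) :
  (E <= DM_meet C D)%O = (E <= C)%O && (E <= D)%O.
Proof.
apply/idP/andP=> [h|[/DM_leP EC /DM_leP ED]].
  by split; apply: le_trans h _; apply: DM_closure_le => x [].
by apply/DM_leP => x Ex; apply: sub_lub; split; [exact: EC|exact: ED].
Qed.

Fact DM_leUx (C D E : DM) :
  (DM_join C D <= E)%O = (C <= E)%O && (D <= E)%O.
Proof.
apply/idP/andP=> [h|[/DM_leP CE /DM_leP DE]].
  by split; apply: le_trans h; apply/DM_leP => x hx;
    apply: sub_lub; [left|right].
by apply: DM_closure_le => x [/CE|/DE].
Qed.

HB.instance Definition _ :=
  Order.POrder_MeetJoin_isLattice.Build set_display DM DM_lexI DM_leUx.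

Lemma DM_complete : complete DM.
Proof.
move=> F; split.
- exists (DM_closure (\bigcup_(C in F) val C)); split=> [C FC|U ubU].
    by apply/DM_leP => x Cx; apply: sub_lub; exists C.
  by apply: DM_closure_le => x [C FC] Cx; move/DM_leP: (ubU C FC); apply.
- exists (DM_closure (\bigcap_(C in F) val C)); split=> [C FC|U lbU].
    by apply: DM_closure_le => x; apply.
  by apply/DM_leP => x Ux; apply: sub_lub => C FC; move/DM_leP: (lbU C FC); apply.
Qed.

Fact down_cut (y : T) : [set z | (z <= y)%O] \in DM_cut.
Proof.
apply/mem_set/seteqP; split; first exact: sub_lub.
by move=> x h; apply: h => z.
Qed.

Definition down (y : T) : DM := exist (fun C => C \in DM_cut) _ (down_cut y).

Lemma down_leP (y : T) (C : DM) : reflect (val C y) (down y <= C)%O.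
Proof.
apply: (iffP (DM_leP _ _)) => [|Cy]; first by apply => /=.
by rewrite [val C]DMP in Cy * => z /= zy u uC; apply: le_trans zy (Cy u uC).
Qed.

End DedekindMacNeille.

Section CanonicalExtension.
Context d (L : latticeType d) (cL : complete L) (Y : set L).

Definition iotabar (x : DM (set_type Y)) : L :=
  csup cL (val @` [set y : Y | (down y <= x)%O]).

Lemma iotabar_down (y : Y) : iotabar (down y) = val y.
Proof.
apply: (@is_subset1_supremums _ _ _ _ _ (csupP _ _)); split.
- by move=> _ /= [z /down_leP zy <-].
- by move=> u; apply; exists y => //=.
Qed.

End CanonicalExtension.

(* Main.v *)
Require Import Defs.
From mathcomp Require Import all_boot all_order.
From mathcomp Require Import boolp classical_sets.

Import Order.LTheory.
Local Open Scope classical_set_scope.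

(** Write [f] for the canonical extension, [f C] being the supremum in [L] of
    the cut [C] of [Y].

    [f] reflects the order: every upper bound [u] of a cut [D] in [Y] lies above
    [f D], so an element [y] of [Y] below [f D] is below all such [u], that is,
    [y] belongs to [D], the set of lower bounds of the upper bounds of [D].
    Binary meets are preserved because meets distribute over suprema in [L].

    The substance is that [f] preserves the suprema of nonempty families
    ([iotabar_sup]).  The supremum of a family of cuts is the closure of their
    union [B], so it must be seen that passing from [B] to its closure creates
    no new upper bounds in [L] ([ubound_DM_closure]).  If [y] is in the closure
    of [B], infinite distributivity of the completion makes [y] the supremum
    of the meets of [y] with the members of [B]; these meets lie in [Y], so by
    regularity their supremum in [L] is still [y], and any upper bound of [B]
    in [L] is above [y].

    Preservation of binary joins is a special case.  Since [f] is moreover an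
    order isomorphism onto its range, a supremum computed in the range is the
    image of a supremum in the completion, hence a supremum in [L]. *)

Section Extension.
Context {d : Order.disp_t} {L : latticeType d} (cL : complete L) (Y : set L).
Implicit Types (C D : DM (set_type Y)) (u : L).
Local Notation f := (iotabar cL (Y := Y)).

Fact sublattice_meet_in (subY : sublattice Y) (y z : Y) :
  Order.meet (val y) (val z) \in Y.
Proof.
by apply/mem_set; apply: (subY _ _ (set_mem (valP y)) (set_mem (valP z))).1.
Qed.

Definition sublattice_meet subY (y z : Y) : Y :=
  exist (fun v => v \in Y) _ (sublattice_meet_in subY y z).

Lemma le_sublattice_meet subY (x y z : Y) :
  (x <= sublattice_meet subY y z)%O = (x <= y)%O && (x <= z)%O.
Proof. exact: lexI. Qed.

Lemma iotabar_leP C u :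
  (f C <= u)%O <-> (forall y : Y, val C y -> (val y <= u)%O).
Proof.
have [ub lub] := csupP cL (val @` [set y : Y | (Defs.down y <= C)%O]).
split=> [Cu y Cy|Cu].
  apply: le_trans Cu.
  by apply: ub; exists y => //=; apply/down_leP.
by apply: lub => _ [y /down_leP Cy <-]; apply: Cu.
Qed.

Lemma le_iotabar C (y : Y) : val C y -> (val y <= f C)%O.
Proof. by move: y; apply/iotabar_leP. Qed.

(** That [f] reflects the order uses only that [D] is a cut: an upper bound of
    [D] in [Y] is an upper bound of [D] in [L], hence above [f D]. *)
Lemma iotabar_mono C D : (f C <= f D)%O = (C <= D)%O.
Proof.
apply/idP/idP => [CD|/DM_leP CD].
  apply/DM_leP => y Cy; rewrite DMP => w wD.
  have fDw : (f D <= val w)%O by apply/iotabar_leP => z /wD.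
  apply: le_trans fDw.
  exact: le_trans (le_iotabar _ _ Cy) CD.
by apply/iotabar_leP => y /CD; apply: le_iotabar.
Qed.

Lemma iotabar_inj : injective f.
Proof.
by move=> C D fCD; apply/le_anti; rewrite -!iotabar_mono fCD lexx.
Qed.

Lemma iotabar_meet : infinitely_distributive L -> sublattice Y ->
  Order.meet_morphism f.
Proof.
move=> [distr _] subY C D.
apply/le_anti/andP; split.
  by rewrite lexI !iotabar_mono leIl leIr.
have meet_sup x E u : (forall y : Y, val E y -> (Order.meet x (val y) <= u)%O) ->
    (Order.meet x (f E) <= u)%O.
  move=> xEu.
  have [_] := distr _ _ x (csupP cL (val @` [set y : Y | (Defs.down y <= E)%O])).
  by apply=> _ [_ [y /down_leP Ey <-] <-]; apply: xEu.
(* Distributivity is used twice, once for each argument of the meet. *)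
apply: (meet_sup) => z Dz; rewrite meetC.
apply: meet_sup => y Cy.
apply: (le_iotabar _ (sublattice_meet subY z y)).
set m := sublattice_meet subY z y.
have /andP[mz my] : (m <= z)%O && (m <= y)%O by rewrite -le_sublattice_meet.
apply: sub_lub; split; rewrite DMP => w.
  by move=> /(_ _ Cy); apply: le_trans.
by move=> /(_ _ Dz); apply: le_trans.
Qed.

Section Suprema.
Hypotheses (rY : regular Y) (dDM : infinitely_distributive (DM (set_type Y))).

(** An element [y] of the closure of [B] is the supremum in [Y] of the meets of
    [y] with the members of [B], by distributivity in the completion; regularity
    carries this supremum over to [L]. *)
Lemma ubound_DM_closure (B : set Y) u : B !=set0 ->
  (forall z, B z -> (val z <= u)%O) ->
  forall y, lbound (ubound B) y -> (val y <= u)%O.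
Proof.
move=> [z0 Bz0] Bu y By.
have [subY supY _] := rY.
pose yz := sublattice_meet subY y.
have supB : supremums [set Defs.down z | z in B] (DM_closure B).
  split=> [_ [z Bz <-]|E BE]; first by apply/down_leP; apply: sub_lub.
  by apply: DM_closure_le => z Bz; apply/down_leP/BE; exists z.
have [_ lub_yB] := dDM.1 _ _ (Defs.down y) supB.
have sup_yz : supremums (yz @` B) y.
  split=> [_ [z _ <-]|w yzw]; first exact: leIl.
  apply/(down_leP y (Defs.down w)).
  have y_le : (Defs.down y <= Order.meet (Defs.down y) (DM_closure B))%O.
    by rewrite lexI lexx; apply/down_leP.
  apply: le_trans y_le _.
  apply: lub_yB => _ [_ [z Bz <-] <-].
  apply: DM_closure_le => v [/= vy vz].
  have yzw' : (yz z <= w)%O by apply: yzw; exists z.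
  apply: le_trans yzw'.
  by rewrite le_sublattice_meet; apply/andP.
have [|_ lub] := supY _ _ _ sup_yz; first by exists (yz z0), z0.
apply: lub => _ [_ [z Bz <-] <-].
exact: le_trans (leIr _ _) (Bu _ Bz).
Qed.

(** The supremum of [A] is below the closure of the union of [A], which has the
    same upper bounds in [L] as the union itself.  The empty family is excluded:
    the least cut goes to the least element of [Y], if there is one, and this
    need not be the least element of [L]. *)
Lemma iotabar_sup (A : set (DM (set_type Y))) C : A !=set0 ->
  supremums A C -> supremums (f @` A) (f C).
Proof.
move=> [D0 AD0] [ubC lubC].
split=> [_ [D AD <-]|u fAu]; first by rewrite iotabar_mono; apply: ubC.
have Au z : (\bigcup_(D in A) val D) z -> (val z <= u)%O.
  move=> [D AD Dz]; apply: le_trans (le_iotabar _ _ Dz) _.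
  by apply: fAu; exists D.
have [[z Az]|A0] := pselect ((\bigcup_(D in A) val D) !=set0).
  have /DM_leP CB : (C <= DM_closure (\bigcup_(D in A) val D))%O.
    by apply: lubC => D AD; apply/DM_leP => y Dy; apply: sub_lub; exists D.
  apply/iotabar_leP => y /CB; apply: ubound_DM_closure Au _.
  by exists z.
(* If the union is empty, then every member of the family is the empty cut,
   and so is its supremum. *)
suff /le_trans : (f C <= f D0)%O by apply; apply: fAu; exists D0.
rewrite iotabar_mono; apply: lubC => D AD.
by apply/DM_leP => y Dy; case: A0; exists y, D.
Qed.

Lemma iotabar_join : Order.join_morphism f.
Proof.
move=> C D; apply/le_anti/andP; split; last first.
  by rewrite leUx !iotabar_mono leUl leUr.
have supCD : supremums [set C; D] (Order.join C D).
  split=> [_ [->|->]|E CDE].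
  - exact: leUl.
  - exact: leUr.
  by rewrite leUx; apply/andP; split; apply: CDE; [left|right].
have [|_] := iotabar_sup _ _ _ supCD; first by exists C; left.
apply=> _ [E [->|->] <-].
- exact: leUl.
- exact: leUr.
Qed.

End Suprema.
End Extension.

(** [f] is an order isomorphism onto its range, so a supremum in the range pulls
    back to one in the domain, which [f] then maps to a supremum in [T']. *)
Lemma join_regular_range {d d' : Order.disp_t} {T : latticeType d}
    {T' : latticeType d'} (f : T -> T') :
  {mono f : x y / (x <= y)%O} -> sublattice (range f) ->
  (forall (A : set T) s, A !=set0 -> supremums A s ->
     supremums (f @` A) (f s)) ->
  join_regular (range f).
Proof.
move=> fmono fsub fsup; split=> // A s [a Aa] [ubs lubs].
pose A' := [set x | exists2 b, A b & f x = val b].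
have A'im (b : range f) : A b -> exists2 x, A' x & f x = val b.
  by move=> Ab; have [x _ fx] := set_mem (valP b); exists x => //; exists b.
have [c _ fc] := set_mem (valP s).
have supc : supremums A' c.
  split=> [x [b Ab fx]|y A'y].
    by rewrite -fmono fx fc; apply: ubs.
  have fyR : f y \in range f by apply/mem_set; exists y.
  rewrite -fmono fc; apply: (lubs (exist (fun v => v \in range f) _ fyR)).
  move=> b /A'im[x A'x fx].
  by change (val b <= f y)%O; rewrite -fx fmono; apply: A'y.
have -> : val @` A = f @` A'.
  apply/seteqP; split=> [_ [b /A'im[x A'x fx] <-]|_ [x [b Ab ->] <-]].
    by exists x.
  by exists b.
rewrite -fc; apply: fsup => //.
by have [x A'x _] := A'im _ Aa; exists x.
Qed.

Theorem corollary3p15 (d : Order.disp_t) (L : latticeType d)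
  (cL : complete L) (dL : infinitely_distributive L)
  (Y : set L) (rY : regular Y)
  (dDM : infinitely_distributive (DM (set_type Y))) :
  lattice_embedding (iotabar cL (Y := Y)) /\
  join_regular (range (iotabar cL (Y := Y))).
Proof.
have [subY _ _] := rY.
have fI := iotabar_meet cL Y dL subY.
have fU := iotabar_join cL Y rY dDM.
split; first by split=> //; apply: iotabar_inj.
apply: join_regular_range.
- exact: iotabar_mono.
- move=> _ _ [C _ <-] [D _ <-]; rewrite -fI -fU.
  by split; [exists (Order.meet C D)|exists (Order.join C D)].
- exact: iotabar_sup.
Qed.
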